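(* Let $k$ be any field, let $Q$ and $Q'$ be finite quivers with rational weights $\theta=(\theta_a)_{a\in Q_0}$ and $\theta'=(\theta'_{a'})_{a'\in Q'_0}$, and let $\overline{\theta}=(\theta_a+\theta'_{a'})_{(a,a')\in Q_0\times Q'_0}$. Let $(V,\rho)$ be a $\theta$-geometrically stable representation of $Q$ over $k$ of type $d$ and let $(W,\sigma)$ be a $\theta'$-geometrically stable representation of $Q'$ over $k$ of type $d'$. Suppose that $d$ is $\theta$-coprime, $d'$ is $\theta'$-coprime, and $\bar d=(d_a d'_{a'})_{(a,a')\in Q_0\times Q'_0}$ is $\overline{\theta}$-coprime. Then the representation $(V,\rho)\otimes(W,\sigma)$ of $Q\otimes Q'$ is $\overline{\theta}$-geometrically stable.
   Context: A quiver $Q=(Q_0,Q_1,\mathrm{s},\mathrm{t})$ consists of finite sets $Q_0\neq\emptyset$ (vertices), $Q_1$ (arrows) and maps $\mathrm{s},\mathrm{t}:Q_1\to Q_0$. A representation $(V,\rho)$ of $Q$ over $k$ is a family $V=(V_a)_{a\in Q_0}$ of finite-dimensional $k$-vector spaces with $k$-linear maps $\rho_\alpha:V_{\mathrm{s}(\alpha)}\to V_{\mathrm{t}(\alpha)}$, $\alpha\in Q_1$. Its type is $(\dim_k V_a)_{a\in Q_0}\in\mathbf{N}^{Q_0}$. A weight of $Q$ is an element $\theta\in\mathbf{R}^{Q_0}$; it is rational if all $\theta_a\in\mathbf{Q}$. For $0\ne d\in\mathbf{N}^{Q_0}$ put $\mu_\theta(d)=\left(\sum_a\theta_a d_a\right)/\left(\sum_a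 d_a\right)$, and let $\mu_\theta(V,\rho)=\mu_\theta(d)$ for a non-zero representation of type $d$. A non-zero representation is $\theta$-stable if $\mu_\theta(W,\sigma)<\mu_\theta(V,\rho)$ for every non-zero proper subrepresentation $(W,\sigma)$. It is $\theta$-geometrically stable if for every field extension $k'$ of $k$ the representation $((V_a\otimes_k k')_{a\in Q_0},(\rho_\alpha\otimes_k\mathbf{1}_{k'})_{\alpha\in Q_1})$ over $k'$ is $\theta$-stable. The vector $d$ is $\theta$-coprime if $\mu_\theta(e)\ne\mu_\theta(d)$ for all $e\in\mathbf{N}^{Q_0}$ with $0<e<d$ (componentwise order: $0\le e\le d$, $e\neq 0$, $e\ne d$). The internal product $Q\otimes Q'$ has vertex set $Q_0\times Q'_0$ and arrow set $(Q_0\times Q'_1)\sqcup(Q_1\times Q'_0)$; an arrow $(a,\alpha')\in Q_0\times Q_1'$ goes from $(a,\mathrm{s}(\alpha'))$ to $(a,\mathrm{t}(\alpha'))$, and an arrow $(\alpha,a')\in Q_1\times Q_0'$ goes from $(\mathrm{s}(\alpha),a')$ to $(\mathrm{t}(\alpha),a')$. The tensor product is the representation $(V,\rho)\otimes(W,\sigma)=((V_a\otimes W_{a'})_{(a,a')},(\tau_\gamma)_\gamma)$ of $Q\otimes Q'$ with $\tau_{(a,\alpha')}=\mathbf{1}_{V_a}\otimes\sigma_{\alpha'}$ and $\tau_{(\alpha,a')}=\rho_\alpha\otimes\mathbf{1}_{W_{a'}}$. *)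

(* Defs.v *)
From HB Require Import structures.
From mathcomp Require Import all_boot all_order all_algebra.
From mathcomp Require Import reals.

Set Implicit Arguments.
Unset Strict Implicit.
Unset Printing Implicit Defensive.

Import Order.TTheory GRing.Theory Num.Theory VectorInternalTheory.
Local Open Scope ring_scope.

Record quiver := Quiver {
  vertex : finType;
  arrow : finType;
  src : arrow -> vertex;
  tgt : arrow -> vertex;
  vertex_gt0 : (0 < #|vertex|)%N }.

Record qrepr (k : fieldType) (Q : quiver) := QRepr {
  rspace : vertex Q -> vectType k;
  rmap : forall al : arrow Q, 'Hom(rspace (src al), rspace (tgt al)) }.

Definition rtype (k : fieldType) (Q : quiver) (V : qrepr k Q)
  (a : vertex Q) : nat := \dim {: rspace V a}.

Definition is_subrepr (k : fieldType) (Q : quiver) (V : qrepr k Q)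
    (U : forall a, {vspace (rspace V a)}) : Prop :=
  forall al : arrow Q, (rmap V al @: U (src al) <= U (tgt al))%VS.

Definition weight (R : realType) (Q : quiver) := vertex Q -> R.

Definition rational_weight (R : realType) (Q : quiver) (theta : weight R Q) :
  Prop := forall a, rational (theta a).

(* Only meaningful for d != 0; it takes the junk value 0 at d = 0. *)
Definition slope (R : realType) (Q : quiver) (theta : weight R Q)
    (d : vertex Q -> nat) : R :=
  (\sum_a theta a * (d a)%:R) / (\sum_a d a)%N%:R.

Definition stable (R : realType) (k : fieldType) (Q : quiver)
    (theta : weight R Q) (V : qrepr k Q) : Prop :=
  (exists a, rtype V a <> 0%N) /\
  forall U : (forall a, {vspace (rspace V a)}),
    is_subrepr U ->
    (exists a, U a <> 0%VS) -> (exists a, U a <> fullv) ->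
    slope theta (fun a => \dim (U a)) < slope theta (rtype V).

Definition coprime_type (R : realType) (Q : quiver) (theta : weight R Q)
    (d : vertex Q -> nat) : Prop :=
  forall e : vertex Q -> nat,
    (forall a, (e a <= d a)%N) ->
    (exists a, e a <> 0%N) -> (exists a, e a <> d a) ->
    slope theta e <> slope theta d.

Section Extension.
Variables (k k' : fieldType) (iota : {rmorphism k -> k'}).

(* V (x)_k k' in the coordinates of V: the vector 1 (x) v is ext_vec v, and
   the lemmas below give the universal property. *)
Definition ext_space (V : vectType k) : vectType k' := 'rV[k']_(dim V).

Definition ext_vec (V : vectType k) (v : V) : ext_space V :=
  map_mx iota (v2r v).

Definition ext_map (V W : vectType k) (f : 'Hom(V, W)) :
    'Hom(ext_space V, ext_space W) :=
  linfun (mulmxr (map_mx iota (f2mx f))).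

Lemma ext_vec_semilinear (V : vectType k) (a : k) (u v : V) :
  ext_vec (a *: u + v) = iota a *: ext_vec u + ext_vec v.
Proof. by rewrite /ext_vec linearP map_mxD map_mxZ. Qed.

Lemma ext_vec_span (V : vectType k) (x : ext_space V) :
  x = \sum_i (x : 'rV_(dim V)) 0 i *: ext_vec (r2v (delta_mx 0 i) : V).
Proof.
rewrite [LHS]row_sum_delta; apply: eq_bigr => i _.
by rewrite /ext_vec r2vK map_delta_mx.
Qed.

Lemma ext_universal (V : vectType k) (U : lmodType k') (h : V -> U) :
  (forall a u v, h (a *: u + v) = iota a *: h u + h v) ->
  exists g : {linear ext_space V -> U}, forall v, g (ext_vec v) = h v.
Proof.
move=> hP.
have h0 : h 0 = 0.
  by apply: (addIr (h 0)); rewrite add0r -[in RHS](addr0 0) -[X in X + 0](scale1r 0)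
     hP rmorph1 scale1r.
have hD u v : h (u + v) = h u + h v by rewrite -{1}[u]scale1r hP rmorph1 scale1r.
have hZ a u : h (a *: u) = iota a *: h u by rewrite -[a *: u]addr0 hP h0 addr0.
pose g (x : ext_space V) : U :=
  \sum_i (x : 'rV_(dim V)) 0 i *: h (r2v (delta_mx 0 i)).
have g_lin : linear g.
  move=> a x y; rewrite /g scaler_sumr -big_split /=; apply: eq_bigr => i _.
  by rewrite !mxE scalerDl scalerA.
pose gL : {linear ext_space V -> U} :=
  HB.pack g (GRing.isLinear.Build _ _ _ _ g g_lin).
exists gL => v; rewrite /= /g -{2}[v]v2rK [X in h (r2v X)]row_sum_delta linear_sum /=.
rewrite (big_morph h hD h0); apply: eq_bigr => i _.
by rewrite linearZ /= hZ mxE.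
Qed.

Lemma ext_linear_ext (V : vectType k) (U : lmodType k')
    (f g : {linear ext_space V -> U}) :
  (forall v, f (ext_vec v) = g (ext_vec v)) -> f =1 g.
Proof.
move=> fg x; rewrite [x]ext_vec_span !linear_sum; apply: eq_bigr => i _.
by rewrite !linearZ /= fg.
Qed.

Lemma ext_mapE (V W : vectType k) (f : 'Hom(V, W)) (v : V) :
  ext_map f (ext_vec v) = ext_vec (f v).
Proof.
rewrite lfunE /= /ext_vec -map_mxM; congr (map_mx _ _).
by rewrite unlock /= r2vK.
Qed.

Definition ext_repr (Q : quiver) (V : qrepr k Q) : qrepr k' Q :=
  @QRepr k' Q (fun a => ext_space (rspace V a)) (fun al => ext_map (rmap V al)).

End Extension.

Definition geom_stable (R : realType) (k : fieldType) (Q : quiver)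
    (theta : weight R Q) (V : qrepr k Q) : Prop :=
  forall (k' : fieldType) (iota : {rmorphism k -> k'}),
    stable theta (ext_repr iota V).

Section Tensor.
Variable k : fieldType.

(* V (x) W as matrices in the coordinates of V and W: the pure tensor of v and
   w is the product of the column of v with the row of w, and the lemmas below
   give the universal property. *)
Definition tens (V W : vectType k) : vectType k := 'M[k]_(dim V, dim W).

Definition tensv (V W : vectType k) (v : V) (w : W) : tens V W :=
  (v2r v)^T *m v2r w.

Definition tens_map (V V' W W' : vectType k)
    (f : 'Hom(V, V')) (g : 'Hom(W, W')) : 'Hom(tens V W, tens V' W') :=
  linfun (mulmxr (f2mx g) \o mulmx (f2mx f)^T).

Lemma tensv_linearl (V W : vectType k) (w : W) :
  linear (fun v : V => tensv v w).
Proof. by move=> a u v; rewrite /tensv !linearP mulmxDl -scalemxAl. Qed.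

Lemma tensv_linearr (V W : vectType k) (v : V) : linear (@tensv V W v).
Proof. by move=> a u w; rewrite /tensv !linearP. Qed.

Lemma tensv_span (V W : vectType k) (x : tens V W) :
  x = \sum_i \sum_j (x : 'M_(dim V, dim W)) i j *:
        tensv (r2v (delta_mx 0 i) : V) (r2v (delta_mx 0 j) : W).
Proof.
rewrite [LHS]matrix_sum_delta; apply: eq_bigr => i _; apply: eq_bigr => j _.
by rewrite /tensv !r2vK trmx_delta mul_delta_mx.
Qed.

Lemma tens_universal (V W : vectType k) (U : lmodType k) (b : V -> W -> U) :
  (forall w, linear (fun v => b v w)) -> (forall v, linear (b v)) ->
  exists g : {linear tens V W -> U}, forall v w, g (tensv v w) = b v w.
Proof.
move=> bl br.
pose bL w : {linear V -> U} :=
  HB.pack (fun v => b v w) (GRing.isLinear.Build _ _ _ _ (fun v => b v w) (bl w)).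
pose bR v : {linear W -> U} :=
  HB.pack (b v) (GRing.isLinear.Build _ _ _ _ (b v) (br v)).
have bZl a v w : b (a *: v) w = a *: b v w by exact: (linearZ_LR (bL w)).
have bZr a v w : b v (a *: w) = a *: b v w by exact: (linearZ_LR (bR v)).
pose g (x : tens V W) : U :=
  \sum_i \sum_j (x : 'M_(dim V, dim W)) i j *:
    b (r2v (delta_mx 0 i)) (r2v (delta_mx 0 j)).
have g_lin : linear g.
  move=> a x y; rewrite /g scaler_sumr -big_split /=; apply: eq_bigr => i _.
  rewrite scaler_sumr -big_split /=; apply: eq_bigr => j _.
  by rewrite !mxE scalerDl scalerA.
pose gL : {linear tens V W -> U} :=
  HB.pack g (GRing.isLinear.Build _ _ _ _ g g_lin).
exists gL => v w; rewrite /= /g.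
rewrite -{2}[v]v2rK -{2}[w]v2rK (row_sum_delta (v2r v)) (row_sum_delta (v2r w)).
rewrite !linear_sum -[RHS]/(bL _ _) linear_sum; apply: eq_bigr => i _.
rewrite /= -[RHS]/(bR _ _) linear_sum; apply: eq_bigr => j _ /=.
rewrite (linearZ_LR (@r2v _ V)) (linearZ_LR (@r2v _ W)) /= bZl bZr.
by rewrite scalerA mxE big_ord1 mxE.
Qed.

Lemma tens_linear_ext (V W : vectType k) (U : lmodType k)
    (f g : {linear tens V W -> U}) :
  (forall v w, f (tensv v w) = g (tensv v w)) -> f =1 g.
Proof.
move=> fg x; rewrite [x]tensv_span !linear_sum; apply: eq_bigr => i _.
rewrite !linear_sum; apply: eq_bigr => j _.
by rewrite !linearZ /= fg.
Qed.

Lemma tens_mapE (V V' W W' : vectType k) (f : 'Hom(V, V')) (g : 'Hom(W, W'))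
    (v : V) (w : W) :
  tens_map f g (tensv v w) = tensv (f v) (g w).
Proof.
rewrite lfunE /= /tensv unlock /= !r2vK.
by rewrite trmx_mul !mulmxA.
Qed.

End Tensor.

Section InternalProduct.
Variables Q Q' : quiver.

Definition iprod_arrow : finType :=
  (vertex Q * arrow Q' + arrow Q * vertex Q')%type.

Definition iprod_src (g : iprod_arrow) : vertex Q * vertex Q' :=
  match g with
  | inl (a, al') => (a, src al')
  | inr (al, a') => (src al, a')
  end.

Definition iprod_tgt (g : iprod_arrow) : vertex Q * vertex Q' :=
  match g with
  | inl (a, al') => (a, tgt al')
  | inr (al, a') => (tgt al, a')
  end.

Lemma iprod_gt0 : (0 < #|{: vertex Q * vertex Q'}|)%N.
Proof. by rewrite card_prod muln_gt0 !vertex_gt0. Qed.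

Definition iprod : quiver := Quiver iprod_src iprod_tgt iprod_gt0.

Variable k : fieldType.

Definition tens_space (V : qrepr k Q) (W : qrepr k Q') (p : vertex iprod) :
  vectType k := tens (rspace V p.1) (rspace W p.2).

Definition tens_rmap (V : qrepr k Q) (W : qrepr k Q') (g : arrow iprod) :
    'Hom(tens_space V W (src g), tens_space V W (tgt g)) :=
  match g with
  | inl (a, al') => tens_map (\1%VF : 'End(rspace V a)) (rmap W al')
  | inr (al, a') => tens_map (rmap V al) (\1%VF : 'End(rspace W a'))
  end.

Definition tens_repr (V : qrepr k Q) (W : qrepr k Q') : qrepr k iprod :=
  @QRepr k iprod (tens_space V W) (tens_rmap V W).

End InternalProduct.

Definition iprod_weight (R : realType) (Q Q' : quiver)
    (theta : weight R Q) (theta' : weight R Q') : weight R (iprod Q Q') :=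
  fun p => theta p.1 + theta' p.2.

Definition iprod_type (Q Q' : quiver)
    (d : vertex Q -> nat) (d' : vertex Q' -> nat) : vertex (iprod Q Q') -> nat :=
  fun p => (d p.1 * d' p.2)%N.

(* Main.v *)
(** Fix a vertex [a'] of [Q'].  Along the arrows [(al, a')], the tensor product
    restricts to a direct sum of copies of [V], so every subrepresentation [U]
    of it satisfies [sum_a (theta_a - mu V) dim U_(a, a') <= 0] because [V] is
    semistable.  Summing over [a'], and adding the symmetric inequality for [W],
    shows that the tensor product is semistable; coprimality of its type makes
    the inequality of slopes strict. *)
Require Import Defs.
From mathcomp Require Import all_boot all_order all_algebra.
From mathcomp Require Import reals.

Set Implicit Arguments.
Unset Strict Implicit.
Unset Printing Implicit Defensive.

Import Order.TTheory GRing.Theory Num.Theory VectorInternalTheory.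
Local Open Scope ring_scope.

(** * Slopes and their linearisation *)

Section Slope.
Variables (R : realType) (Q : quiver) (theta : weight R Q).

(** Linear substitute for comparing a slope with [mu]: its sign decides the comparison when [d] is
    nonzero, it is additive in [d], and it is harmless at [d = 0], where [slope] takes a junk
    value. *)
Definition excess (mu : R) (d : vertex Q -> nat) : R :=
  \sum_a (theta a - mu) * (d a)%:R.

Lemma eq_slope (d e : vertex Q -> nat) : d =1 e -> slope theta d = slope theta e.
Proof.
move=> de; rewrite /slope; congr (_ / _%:R); last by apply: eq_bigr => a _.
by apply: eq_bigr => a _; rewrite de.
Qed.

Lemma excessE (mu : R) (d : vertex Q -> nat) :
  excess mu d = \sum_a theta a * (d a)%:R - mu * (\sum_a d a)%N%:R.
Proof.
rewrite /excess natr_sum mulr_sumr -sumrB.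
by apply: eq_bigr => a _; rewrite mulrBl.
Qed.

Lemma total_gt0 (d : vertex Q -> nat) :
  (exists a, d a <> 0%N) -> (0 < \sum_a d a)%N.
Proof.
move=> [a /eqP da]; rewrite lt0n sum_nat_eq0.
by apply/forallPn; exists a.
Qed.

Lemma slope_le (mu : R) (d : vertex Q -> nat) :
  (exists a, d a <> 0%N) -> (slope theta d <= mu) = (excess mu d <= 0).
Proof.
move=> /total_gt0 d_gt0.
by rewrite /slope ler_pdivrMr ?ltr0n // excessE subr_le0.
Qed.

Lemma excess_slope (d : vertex Q -> nat) :
  (exists a, d a <> 0%N) -> excess (slope theta d) d = 0.
Proof.
move=> /total_gt0 d_gt0; rewrite excessE /slope divfK ?subrr //.
by rewrite pnatr_eq0 -lt0n.
Qed.

(** Semistability in additive form. Stability says nothing about the zero and the full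
    subrepresentation, but both have excess exactly 0. *)
Lemma stable_excess (k : fieldType) (V : qrepr k Q)
    (U : forall a, {vspace (rspace V a)}) :
  stable theta V -> is_subrepr U ->
  excess (slope theta (rtype V)) (fun a => \dim (U a)) <= 0.
Proof.
move=> [V_neq0 V_stable] U_sub.
have [U_eq0|/forallPn[a Ua]] := boolP [forall a, U a == 0%VS].
  rewrite /excess big1 // => a _.
  by rewrite (eqP (forallP U_eq0 a)) dimv0 mulr0.
have Ua' : U a <> 0%VS by apply/eqP.
have [U_full|/forallPn[b Ub]] := boolP [forall a, U a == fullv].
  rewrite le_eqVlt -(excess_slope V_neq0); apply/orP; left; apply/eqP.
  by apply: eq_bigr => b _; rewrite (eqP (forallP U_full b)).
rewrite -slope_le; last by exists a; apply/eqP; rewrite dimv_eq0; apply/eqP.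
by apply/ltW/V_stable => //; [exists a | exists b; apply/eqP].
Qed.

End Slope.

(** * Subrepresentations of direct sums of copies of a stable representation *)

Section SubrepresentationOfCopies.
Variables (R : realType) (k : fieldType) (Q : quiver) (theta : weight R Q).
Variables (V X : qrepr k Q) (J : eqType).
Variable p : J -> forall a, 'Hom(rspace X a, rspace V a).
Hypothesis p_hom : forall j al x,
  p j (tgt al) (rmap X al x) = rmap V al (p j (src al) x).

Lemma subrepr_img j (U : forall a, {vspace (rspace X a)}) :
  is_subrepr U -> is_subrepr (V := V) (fun a => p j a @: U a)%VS.
Proof.
move=> U_sub al; apply/subvP => /= _ /memv_imgP[_ /memv_imgP[u uU ->] ->].
by rewrite -p_hom memv_img // (subvP (U_sub al)) // memv_img.
Qed.

Lemma subrepr_ker j (U : forall a, {vspace (rspace X a)}) :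
  is_subrepr U -> is_subrepr (V := X) (fun a => U a :&: lker (p j a))%VS.
Proof.
move=> U_sub al; apply/subvP => /= _ /memv_imgP[u /memv_capP[uU pu] ->].
apply/memv_capP; split; first by rewrite (subvP (U_sub al)) ?memv_img.
by rewrite memv_ker p_hom; move: pu; rewrite memv_ker => /eqP->; rewrite linear0.
Qed.

(** The morphisms [p j] with [j] in [s] embed [U] into a power of [V]. Induction peels off one
    factor: the image of [U] in it is a subrepresentation of [V], and the remaining morphisms are
    still jointly injective on the kernel. *)
Lemma jointly_injective_excess (s : seq J) (U : forall a, {vspace (rspace X a)}) :
  stable theta V -> is_subrepr U ->
  (forall a u, u \in U a -> (forall j, j \in s -> p j a u = 0) -> u = 0) ->
  excess theta (slope theta (rtype V)) (fun a => \dim (U a)) <= 0.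
Proof.
move=> V_stable; elim: s U => [|j s IHs] U U_sub U_inj.
  rewrite /excess big1 // => a _.
  suff -> : U a = 0%VS by rewrite dimv0 mulr0.
  by apply/eqP; rewrite -subv0; apply/subvP => u uU; rewrite memv0 (U_inj a u uU).
(* Rank-nullity at each vertex, carried through the additivity of [excess]. *)
rewrite (_ : excess _ _ _ =
    excess theta (slope theta (rtype V)) (fun a => \dim (U a :&: lker (p j a)))
  + excess theta (slope theta (rtype V)) (fun a => \dim (p j a @: U a))); last first.
  rewrite /excess -big_split; apply: eq_bigr => a _ /=.
  by rewrite -mulrDr -natrD limg_ker_dim.
rewrite -[leRHS]addr0 lerD //; last exact/stable_excess/subrepr_img.
apply: IHs => [|a u]; first exact: subrepr_ker.
move=> /memv_capP[uU /[!memv_ker] /eqP pu] su; apply: (U_inj a) => // i.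
by rewrite inE => /predU1P[->|/su].
Qed.

End SubrepresentationOfCopies.

(** * Functoriality of extension of scalars *)

Section ExtFunctor.
Variables (k k' : fieldType) (iota : {rmorphism k -> k'}).

Lemma ext_map_square (A B C D : vectType k) (f : 'Hom(A, B)) (g : 'Hom(B, D))
    (f' : 'Hom(A, C)) (g' : 'Hom(C, D)) :
  (forall v, g (f v) = g' (f' v)) ->
  forall x, ext_map iota g (ext_map iota f x) = ext_map iota g' (ext_map iota f' x).
Proof.
move=> comm x.
(* Written as composites, both sides are linear over [k'], so it suffices to compare them on the
   vectors [ext_vec v], which span. *)
rewrite -[LHS]comp_lfunE -[RHS]comp_lfunE; move: x.
apply: (ext_linear_ext (iota := iota)) => v.
by rewrite /= !comp_lfunE !ext_mapE comm.
Qed.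

(** Joint injectivity of the [q j] must be known over [k']; witnessing it by an identity between
    linear maps lets it pass through the base change. *)
Lemma ext_map_decomposition (A B : vectType k) (J : finType)
    (i : J -> 'Hom(B, A)) (q : J -> 'Hom(A, B)) :
  (forall v, v = \sum_j i j (q j v)) ->
  forall x, x = \sum_j ext_map iota (i j) (ext_map iota (q j) x).
Proof.
move=> dec x.
under eq_bigr do rewrite -comp_lfunE.
rewrite -sum_lfunE -[LHS]id_lfunE; move: x.
apply: (ext_linear_ext (iota := iota)) => v.
rewrite /= id_lfunE sum_lfunE.
under eq_bigr do rewrite comp_lfunE !ext_mapE.
rewrite {1}[v]dec (big_morph (@ext_vec _ _ iota A) (id1 := 0) (op1 := +%R)) //.
  by move=> u w; rewrite /ext_vec linearD map_mxD.
by rewrite /ext_vec linear0 map_mx0.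
Qed.

Lemma rtype_ext (Q : quiver) (V : qrepr k Q) a : rtype (ext_repr iota V) a = rtype V a.
Proof. by rewrite /rtype !dimvf /= dim_matrix; apply: mul1n. Qed.

End ExtFunctor.

(** * Coordinate contractions of a tensor product *)

Section Contraction.
Variables (k : fieldType) (V W : vectType k).

(** Contraction with the [j]-th coordinate functional of [W]: the pure tensor of [v] and [w] goes to
    [w_j v], read off as column [j] of the matrix. *)
Definition contractr (j : 'I_(dim W)) : 'Hom(tens V W, V) :=
  linfun (r2v \o trmx \o col j).

Definition contractl (i : 'I_(dim V)) : 'Hom(tens V W, W) :=
  linfun (r2v \o row i).

(** Tensoring on the right with the [j]-th basis vector of [W], which puts a column back in its
    place. *)
Definition insertr (j : 'I_(dim W)) : 'Hom(V, tens V W) :=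
  linfun (mulmxr (delta_mx 0 j) \o trmx \o v2r).

Definition insertl (i : 'I_(dim V)) : 'Hom(W, tens V W) :=
  linfun (mulmx (delta_mx i 0) \o v2r).

Lemma contractr_decomposition (x : tens V W) :
  x = \sum_j insertr j (contractr j x).
Proof.
under eq_bigr do rewrite !lfunE /= r2vK trmxK.
apply/matrixP => a b; rewrite summxE (bigD1 b) //= big1 ?addr0 => [|c cb].
  by rewrite !mxE big_ord1 !mxE !eqxx mulr1.
by rewrite !mxE big_ord1 !mxE [b == c]eq_sym (negPf cb) andbF mulr0.
Qed.

Lemma contractl_decomposition (x : tens V W) :
  x = \sum_i insertl i (contractl i x).
Proof.
under eq_bigr do rewrite !lfunE /= r2vK.
apply/matrixP => a b; rewrite summxE (bigD1 a) //= big1 ?addr0 => [|c ca].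
  by rewrite !mxE big_ord1 !mxE !eqxx mul1r.
by rewrite !mxE big_ord1 !mxE eq_sym (negPf ca) mul0r.
Qed.

End Contraction.

Arguments contractr {k V W} j.
Arguments contractl {k V W} i.

(** * Excess of a subrepresentation along the slices of the internal product *)

Section TensorExcess.
Variables (k : fieldType).

Lemma lfun_f2mx (V W : vectType k) (f : 'Hom(V, W)) v : f v = r2v (v2r v *m f2mx f).
Proof. by rewrite unlock. Qed.

Lemma f2mx1 (V : vectType k) : f2mx (\1%VF : 'End(V)) = 1%:M.
Proof.
apply/row_matrixP => i; rewrite !rowE; move: (delta_mx _ _) => v.
by rewrite mulmx1 -[RHS]r2vK -[in RHS](id_lfunE (r2v v)) lfun_f2mx !r2vK.
Qed.

(** A map acting on the left factor alone multiplies the matrix from the left, hence acts on each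
    column separately. *)
Lemma contractr_hom (V V' W : vectType k) (f : 'Hom(V, V')) j (x : tens V W) :
  contractr j (tens_map f \1%VF x) = f (contractr j x).
Proof.
rewrite !lfunE /= lfun_f2mx r2vK; congr r2v.
by rewrite f2mx1 mulmx1 !colE !trmx_mul trmxK mulmxA.
Qed.

Lemma contractl_hom (V W W' : vectType k) (g : 'Hom(W, W')) i (x : tens V W) :
  contractl i (tens_map \1%VF g x) = g (contractl i x).
Proof.
by rewrite !lfunE /= f2mx1 trmx1 mul1mx lfun_f2mx r2vK row_mul.
Qed.

Variables (R : realType) (Q Q' : quiver) (V : qrepr k Q) (W : qrepr k Q').
Variables (k' : fieldType) (iota : {rmorphism k -> k'}).
Variable U : forall p, {vspace (rspace (ext_repr iota (tens_repr V W)) p)}.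
Hypothesis U_sub : is_subrepr U.

Lemma tens_excessl (theta : weight R Q) (a' : vertex Q') :
  stable theta (ext_repr iota V) ->
  excess theta (slope theta (rtype (ext_repr iota V)))
    (fun a => \dim (U (a, a'))) <= 0.
Proof.
move=> V_stable.
(* [X] is the restriction of the extended tensor product to the copy of [Q] at [a']; the extended
   contractions are its projections to copies of the extension of [V]. *)
pose X := @QRepr k' Q (fun a => ext_space k' (tens (rspace V a) (rspace W a')))
  (fun al => ext_map iota (tens_map (rmap V al) \1%VF)).
apply: (@jointly_injective_excess _ _ _ theta (ext_repr iota V) X
  'I_(dim (rspace W a')) (fun j a => ext_map iota (contractr j)) _
  (enum 'I_(dim (rspace W a'))) (fun a => U (a, a'))) => //.
- by move=> j al; apply: ext_map_square => v; apply: contractr_hom.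
- by move=> al; apply: (U_sub (inr (al, a'))).
(* Joint injectivity: a vector is rebuilt from its contractions, so it vanishes when they all do. *)
- move=> a u _ u0; rewrite [u](ext_map_decomposition iota (@contractr_decomposition _ _ _)).
  by rewrite big1 // => j _; rewrite u0 ?mem_enum // linear0.
Qed.

Lemma tens_excessr (theta : weight R Q') (a : vertex Q) :
  stable theta (ext_repr iota W) ->
  excess theta (slope theta (rtype (ext_repr iota W)))
    (fun a' => \dim (U (a, a'))) <= 0.
Proof.
move=> W_stable.
pose X := @QRepr k' Q' (fun a' => ext_space k' (tens (rspace V a) (rspace W a')))
  (fun al => ext_map iota (tens_map \1%VF (rmap W al))).
apply: (@jointly_injective_excess _ _ _ theta (ext_repr iota W) X
  'I_(dim (rspace V a)) (fun i a' => ext_map iota (contractl i)) _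
  (enum 'I_(dim (rspace V a))) (fun a' => U (a, a'))) => //.
- by move=> i al; apply: ext_map_square => v; apply: contractl_hom.
- by move=> al; apply: (U_sub (inl (a, al))).
- move=> a' u _ u0; rewrite [u](ext_map_decomposition iota (@contractl_decomposition _ _ _)).
  by rewrite big1 // => j _; rewrite u0 ?mem_enum // linear0.
Qed.

End TensorExcess.

(** * Excess and slope on the internal product *)

Lemma iprod_excess (R : realType) (Q Q' : quiver) (theta : weight R Q)
    (theta' : weight R Q') (mu mu' : R) (e : vertex (iprod Q Q') -> nat) :
  excess (iprod_weight theta theta') (mu + mu') e =
    \sum_a' excess theta mu (fun a => e (a, a'))
  + \sum_a excess theta' mu' (fun a' => e (a, a')).
Proof.
rewrite /excess exchange_big /= !pair_bigA /= -big_split /=.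
(* The coefficient at [(a, a')] splits as [(theta a - mu) + (theta' a' - mu')]. *)
by apply: eq_bigr => -[a a'] _ /=; rewrite -mulrDl /iprod_weight addrACA opprD.
Qed.

Lemma iprod_slope (R : realType) (Q Q' : quiver) (theta : weight R Q)
    (theta' : weight R Q') (d : vertex Q -> nat) (d' : vertex Q' -> nat) :
  (exists a, d a <> 0%N) -> (exists a', d' a' <> 0%N) ->
  slope (iprod_weight theta theta') (iprod_type d d') =
  slope theta d + slope theta' d'.
Proof.
move=> d_neq0 d'_neq0.
have [a da] := d_neq0; have [a' da'] := d'_neq0.
have dd'_neq0 : exists p, iprod_type d d' p <> 0%N.
  by exists (a, a'); apply/eqP; rewrite muln_eq0 negb_or; apply/andP; split; apply/eqP.
have dd'_gt0 := total_gt0 dd'_neq0.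
(* The slope is the value at which the excess vanishes. Each slice of the product type is a multiple
   of [d] or of [d'], whose excess at its own slope is 0. *)
have : excess (iprod_weight theta theta') (slope theta d + slope theta' d')
    (iprod_type d d') = 0.
  rewrite iprod_excess /iprod_type /= !big1 ?addr0 // => b _.
    rewrite /excess; under eq_bigr do rewrite natrM mulrCA.
    by rewrite -mulr_sumr -/(excess _ _ _) excess_slope ?mulr0.
  rewrite /excess; under eq_bigr do rewrite natrM mulrA.
  by rewrite -mulr_suml -/(excess _ _ _) excess_slope ?mul0r.
rewrite excessE => /subr0_eq eq; rewrite {1}/slope eq mulfK //.
by rewrite pnatr_eq0 -lt0n.
Qed.

Theorem corollary2p7 (R : realType) (k : fieldType) (Q Q' : quiver)
    (theta : weight R Q) (theta' : weight R Q')
    (theta_rat : rational_weight theta) (theta'_rat : rational_weight theta')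
    (V : qrepr k Q) (W : qrepr k Q')
    (d : vertex Q -> nat) (d' : vertex Q' -> nat)
    (V_type : forall a, rtype V a = d a) (W_type : forall a', rtype W a' = d' a')
    (V_stable : geom_stable theta V) (W_stable : geom_stable theta' W)
    (d_coprime : coprime_type theta d) (d'_coprime : coprime_type theta' d')
    (dd'_coprime : coprime_type (iprod_weight theta theta') (iprod_type d d')) :
  geom_stable (iprod_weight theta theta') (tens_repr V W).
Proof.
move=> k' iota.
have V'_type a : rtype (ext_repr iota V) a = d a by rewrite rtype_ext.
have W'_type a : rtype (ext_repr iota W) a = d' a by rewrite rtype_ext.
have T_type p : rtype (ext_repr iota (tens_repr V W)) p = iprod_type d d' p.
  by rewrite rtype_ext /rtype dimvf /= dim_matrix -!dimvf /iprod_type -V_type -W_type.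
have {}V_stable := V_stable _ iota; have {}W_stable := W_stable _ iota.
have [[a]] := V_stable; rewrite V'_type => da _.
have [[a']] := W_stable; rewrite W'_type => da' _.
split=> [|U U_sub [b Ub] [c Uc]].
  exists (a, a'); rewrite T_type.
  by apply/eqP; rewrite muln_eq0 negb_or; apply/andP; split; apply/eqP.
have Ub0 : exists p, \dim (U p) <> 0%N.
  by exists b; apply/eqP; rewrite dimv_eq0; apply/eqP.
(* Coprimality of the product type rules out equality of slopes: [b] shows that the type of [U] is
   nonzero, [c] that it is not the full type. Only the weak inequality then remains. *)
rewrite (eq_slope _ T_type) lt_neqAle; apply/andP; split.
  apply/eqP; apply: dd'_coprime => //.
    by move=> p; rewrite -T_type dimvS // subvf.
  exists c; rewrite -T_type => Uc_dim; apply: Uc; apply/eqP.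
  by rewrite eqEdim subvf Uc_dim /rtype leqnn.
(* The target slope is the sum of the two slopes, so the excess of [U] there is a sum of slice
   excesses, each at most 0. *)
rewrite iprod_slope; [|by exists a|by exists a'].
rewrite slope_le // iprod_excess -(eq_slope theta V'_type) -(eq_slope theta' W'_type).
rewrite -[leRHS]addr0 lerD //; apply: sumr_le0 => x _.
  exact: tens_excessl.
exact: tens_excessr.
Qed.
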